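(* Let $W\leq S\leq T(X)$ and $U\subseteq T(X)$ with $U\cap W=\emptyset$ such that $\langle W,\alpha\rangle = T(X)$ for all $\alpha\in U$. Then the following statements are equivalent: (i) $S$ is a maximal subsemigroup of $T(X)$. (ii) There is an $H\in\mathcal{H}(U,W)$ with $S=T(X)\setminus H$.
   Context: $X$ is a countably infinite set (one may take $X=\mathbb{N}$) and $T(X)$ is the monoid of all full transformations (maps $X\to X$) under composition. $A\leq B$ means that $A$ is a subsemigroup of $B$; $\langle A\rangle$ is the subsemigroup generated by $A$, and $\langle W,\alpha\rangle=\langle W\cup\{\alpha\}\rangle$. A subsemigroup $S$ of $T(X)$ is maximal if $S\neq T(X)$ and there is no subsemigroup of $T(X)$ lying strictly between $S$ and $T(X)$. For a set $M$ of subsets of $T(X)$, let $J(M)$ be the set of all $A\subseteq T(X)$ such that: $A\subseteq\bigcup M=\{a\mid \exists m\in M,\ a\in m\}$; $A\cap m\neq\emptyset$ for all $m\in M$; and for every $\alpha\in A$ there exists $m\in M$ with $A\cap m=\{\alpha\}$. For $U\subseteq T(X)$ and $W\leq T(X)$ put $Gen(U)=\{A\subseteq T(X)\mid A \text{ is finite and } \langle A\rangle\cap U\neq\emptyset\}$ and $\mathcal{H}(U,W)=\{A\subseteq T(X)\setminus W\mid A\in J(Gen(U))\}$.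
   Formalization: The formal theorem additionally assumes that U is nonempty; for U = ∅ the equivalence fails, since H(∅,W) = {∅} makes (ii) say S = T(X), which (i) excludes (e.g. W = S = T(X)). *)

(* Defs.v *)
From mathcomp Require Import all_boot.
From mathcomp Require Import boolp classical_sets functions cardinality.

Set Implicit Arguments.
Unset Strict Implicit.
Unset Printing Implicit Defensive.

Local Open Scope classical_set_scope.

(* The monoid T(X) of full transformations of X is the type X -> X under
   composition, and subsets of T(X) are terms of type set (X -> X).  All notions
   below are the same whether maps are composed from left to right or from right
   to left. *)

(* The empty set counts as a subsemigroup. *)
Definition subsemigroup (X : Type) (S : set (X -> X)) : Prop :=
  forall f g, S f -> S g -> S (f \o g).

(* Generation is as a semigroup, so the identity map is not adjoined. *)
Definition generated (X : Type) (A : set (X -> X)) : set (X -> X) :=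
  smallest (@subsemigroup X) A.

Definition maximal_subsemigroup (X : Type) (S : set (X -> X)) : Prop :=
  [/\ subsemigroup S,
      S <> [set: X -> X] &
      ~ exists R, [/\ subsemigroup R, S `<` R & R `<` [set: X -> X]]].

Definition J (T : Type) (M : set (set T)) : set (set T) :=
  [set A | [/\ A `<=` \bigcup_(m in M) m,
               forall m, M m -> A `&` m !=set0 &
               forall a, A a -> exists2 m, M m & A `&` m = [set a]]].

Definition Gen (X : Type) (U : set (X -> X)) : set (set (X -> X)) :=
  [set A | finite_set A /\ generated A `&` U !=set0].

Definition calH (X : Type) (U W : set (X -> X)) : set (set (X -> X)) :=
  [set A | A `<=` [set: X -> X] `\` W /\ J (Gen U) A].

(* Main.v *)
Require Import Defs.
From mathcomp Require Import all_boot.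
From mathcomp Require Import boolp classical_sets functions cardinality.

(* Every element of a generated semigroup is generated by finitely many of the
   generators.  Hence, for h outside a maximal S, some element of U lies in a
   semigroup generated by h and finitely many elements of S, which gives the
   privacy condition defining J for the complement of S.  Conversely, that
   condition puts an element of U into every semigroup R strictly above S, and
   R = T(X) because R also contains W. *)

Local Open Scope classical_set_scope.

Lemma generated_subsemigroup (X : Type) (A : set (X -> X)) :
  subsemigroup (generated A).
Proof.
move=> f g Af Ag B [Bsub AB].
by apply: (Bsub); [exact: Af|exact: Ag].
Qed.

Lemma sub_generated (X : Type) (A : set (X -> X)) : A `<=` generated A.
Proof. exact: sub_gen_smallest. Qed.

Lemma generated_sub (X : Type) (A B : set (X -> X)) :
  subsemigroup B -> A `<=` B -> generated A `<=` B.
Proof. exact: smallest_sub. Qed.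

Lemma generatedS (X : Type) (A B : set (X -> X)) :
  A `<=` B -> generated A `<=` generated B.
Proof.
move=> AB; apply: generated_sub; first exact: generated_subsemigroup.
exact: subset_trans AB (@sub_generated _ _).
Qed.

(** The maps generated by finite subsets of [B] form a subsemigroup containing [B]: for a composite,
    take the union of the finite sets of its two factors. *)
Lemma generated_finite (X : Type) (B : set (X -> X)) (f : X -> X) :
  generated B f -> exists A, [/\ finite_set A, A `<=` B & generated A f].
Proof.
move: f; apply: generated_sub => [f g|f Bf].
  move=> [A1 [fA1 A1B A1f]] [A2 [fA2 A2B A2g]].
  exists (A1 `|` A2); split; first by rewrite finite_setU.
    by rewrite subUset.
  apply: generated_subsemigroup.
    by apply: generatedS A1f; exact: subsetUl.
  by apply: generatedS A2g; exact: subsetUr.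
exists [set f]; split; first exact: finite_set1.
  by move=> _ ->.
exact: sub_generated.
Qed.

Lemma maximal_subsemigroup_generated {X : Type} {S : set (X -> X)}
    {a : X -> X} :
  maximal_subsemigroup S -> ~ S a -> generated (S `|` [set a]) = [set: X -> X].
Proof.
move=> [_ _ Smax] nSa; apply: contrapT => gennT; apply: Smax.
exists (generated (S `|` [set a])); split.
- exact: generated_subsemigroup.
- split; first exact: subset_trans (@subsetUl _ _ _) (@sub_generated _ _).
  by move=> /(_ a) genS; apply/nSa/genS; apply: sub_generated; right.
- by split=> // Tgen; apply: gennT; apply/seteqP; split.
Qed.

(** Applied with [R := S] it shows that a proper [S] misses [U]; applied to an [R] strictly above
    [S] it yields maximality. *)
Lemma subsemigroup_meets_full {X : Type} {W U R : set (X -> X)} {u : X -> X} :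
  (forall a, U a -> generated (W `|` [set a]) = [set: X -> X]) ->
  subsemigroup R -> W `<=` R -> U u -> R u -> R = [set: X -> X].
Proof.
move=> U_gen Rsub WR Uu Ru; apply/seteqP; split=> //.
rewrite -(U_gen u Uu); apply: generated_sub => //.
by move=> f [/WR|->].
Qed.

Theorem theorem3 (X : Type)
    (X_countable : countable [set: X]) (X_infinite : infinite_set [set: X])
    (W S U : set (X -> X))
    (W_sub : subsemigroup W) (S_sub : subsemigroup S) (WS : W `<=` S)
    (U_nonempty : U !=set0) (UW : U `&` W = set0)
    (U_gen : forall a, U a -> generated (W `|` [set a]) = [set: X -> X]) :
  maximal_subsemigroup S <->
  exists2 H, calH U W H & S = [set: X -> X] `\` H.
Proof.
split=> [Smax|[H [_ [_ Hmeets Hprivate]] SE]].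
  have private a : ~ S a -> exists2 m, Gen U m & ~` S `&` m = [set a].
    move=> nSa; have [u Uu] := U_nonempty.
    have : generated (S `|` [set a]) u.
      by rewrite (maximal_subsemigroup_generated Smax nSa).
    move=> /generated_finite [A [finA ASa Au]].
    (* Adjoining [a] makes the part outside [S] exactly [[set a]], with no need to know whether [a]
       is in [A]. *)
    exists (A `|` [set a]).
      split; first by rewrite finite_setU; split=> //; exact: finite_set1.
      by exists u; split=> //; apply: generatedS Au; exact: subsetUl.
    apply/seteqP; split=> [f [nSf [/ASa[]|]]//|_ ->].
    by split=> //; right.
  exists (~` S); last by rewrite setTD setCK.
  split; first by move=> f nSf; split=> // /WS.
  split=> [a /private[m mU ma]|m [_ [u [mu Uu]]]|a /private//].
    exists m => //; have : [set a] a by [].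
    by rewrite -ma => -[].
  (* If [m] lay inside [S], then [u] would be in [S], forcing [S] to be all of T(X). *)
  apply: contrapT => nSm; case: (Smax) => _ SnT _; apply: SnT.
  apply: (subsemigroup_meets_full U_gen S_sub WS Uu).
  apply: generated_sub mu => // f mf.
  by apply: contrapT => nSf; apply: nSm; exists f.
split=> //.
  (* The singleton of an element of [U] belongs to [Gen U], so [H] is nonempty and its complement is
     proper. *)
  move=> ST; have [u Uu] := U_nonempty.
  have [|h [Hh _]] := Hmeets [set u].
    by split; [exact: finite_set1|exists u; split=> //; exact: sub_generated].
  by have [] : ([set: X -> X] `\` H) h by rewrite -SE ST.
move=> [R [Rsub [SR nRS] [_ nTR]]]; apply: nTR.
have [a [Ra nSa]] : exists a, R a /\ ~ S a.
  by apply: contrapT => noa; apply: nRS => a Ra; apply: contrapT => nSa;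
     apply: noa; exists a.
have Ha : H a by apply: contrapT => nHa; apply: nSa; rewrite SE.
have [m [_ [u [mu Uu]]] Hm] := Hprivate a Ha.
rewrite (subsemigroup_meets_full U_gen Rsub (subset_trans WS SR) Uu) //.
(* The only element of [m] in [H] is [a], which is in [R]; all others lie in [S], so [m] is inside
   [R]. *)
apply: generated_sub mu => // f mf.
have [Hf|nHf] := pselect (H f); last by apply: SR; rewrite SE.
by have : (H `&` m) f by []; rewrite Hm => ->.
Qed.
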